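(* Let $R$ be a commutative ring with identity, $r\in R$, $n$ a positive integer, and $c_0,\ldots,c_{n-1}\in R$. Let $C_{n,r}=\mathrm{circ}_{n,r}(c_0,\ldots,c_{n-1})$ be the corresponding $r$-circulant matrix, and let $[C_{n,r}]=[c_0,\ldots,c_{n-1},0,0,\ldots]$ be the associated infinite semicirculant matrix. For any nonnegative integer $k$, write $$T_{n,r}([C_{n,r}]^k)=[b_0(k),b_1(k),b_2(k),\ldots],$$ where $T_{n,r}$ is the linear map on matrices defined by $$T_{n,r}\big((a_{ij})\big)=\Big(r^{\lfloor |j-i|/n\rfloor}\Big)\odot (a_{ij}).$$ Then $$C_{n,r}^k=\sum_{m\ge 0}\mathrm{circ}_{n,r}\big(b_{nm}(k),b_{nm+1}(k),\ldots,b_{n(m+1)-1}(k)\big).$$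
   Context: The $r$-circulant matrix $\mathrm{circ}_{n,r}(c_0,\ldots,c_{n-1})$ is the $n\times n$ matrix over $R$ whose $(i,j)$ entry ($1\le i,j\le n$) is $c_{j-i}$ if $j\ge i$ and $r\,c_{n+j-i}$ if $j<i$: $$\begin{pmatrix} c_0&c_1&c_2&\cdots&c_{n-2}&c_{n-1}\\ rc_{n-1}&c_0&c_1&\cdots&c_{n-3}&c_{n-2}\\ rc_{n-2}&rc_{n-1}&c_0&\cdots&c_{n-4}&c_{n-3}\\ \vdots&&&&&\vdots\\ rc_1&rc_2&rc_3&\cdots&rc_{n-1}&c_0\end{pmatrix}.$$ For a sequence $\{d_s\}_{s\ge0}$ in $R$, the infinite semicirculant matrix $[d_0,d_1,d_2,\ldots]$ is the upper triangular Toeplitz matrix with rows and columns indexed by the positive integers whose $(i,j)$ entry is $d_{j-i}$ if $j\ge i$ and $0$ if $j<i$. Products of such matrices are well defined (each entry is a finite sum) and are again semicirculant. $\odot$ denotes the Hadamard (entrywise) product, $\lfloor x\rfloor$ the greatest integer less than or equal to $x$, and $r^0=1$. The map $T_{n,r}$ is applied to finite or infinite matrices over $R$ and sends semicirculant matrices to semicirculant matrices. Since $[C_{n,r}]^k$ has only finitely many nonzero strips (diagonals), only finitely many $b_s(k)$ are nonzero, so the sum over $m\ge0$ is finite. *)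

(* Defs.v *)
From HB Require Import structures.
From mathcomp Require Import all_boot all_order all_algebra.
From mathcomp Require Import mathcomp_extra boolp classical_sets functions.
From mathcomp Require Import cardinality fsbigop.

Set Implicit Arguments.
Unset Strict Implicit.
Unset Printing Implicit Defensive.

Import GRing.Theory.

Local Open Scope classical_set_scope.
Local Open Scope ring_scope.

(* All indices start at 0.  The entries of the matrices below depend on the
   indices i, j only through j - i, so this agrees with 1-based indexing. *)

Definition circ (R : comPzRingType) (n : nat) (r : R) (c : n.-tuple R) : 'M[R]_n :=
  \matrix_(i < n, j < n)
     if (i <= j)%N then c`_(j - i) else r * c`_(n + j - i).

Definition infmx (R : Type) := nat -> nat -> R.

Definition semicirc (R : comPzRingType) (d : nat -> R) : infmx R :=
  fun i j => if (i <= j)%N then d (j - i)%N else 0.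

(* A finitely supported sum (0 by convention when the support is infinite); on
   semicirculant factors the support is finite, [infmx_mul_semicirc_supp]. *)
Definition infmx_mul (R : comPzRingType) (A B : infmx R) : infmx R :=
  fun i j => \sum_(l \in [set: nat]) (A i l * B l j).

Definition infmx_one (R : comPzRingType) : infmx R := fun i j => (i == j)%:R.

Definition infmx_exp (R : comPzRingType) (A : infmx R) (k : nat) : infmx R :=
  iter k (infmx_mul A) (infmx_one R).

Definition infmx_hadamard (R : comPzRingType) (A B : infmx R) : infmx R :=
  fun i j => A i j * B i j.

(* [`|j - i|%N] is the distance of the naturals i and j, and [%/] rounds down. *)
Definition transT (R : comPzRingType) (n : nat) (r : R) (A : infmx R) : infmx R :=
  infmx_hadamard (fun i j => r ^+ (`|j - i|%N %/ n)) A.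

(* A tuple is padded with zeros by [_`_s], so this is [c_0,...,c_(n-1),0,0,...]. *)
Definition semicirc_of (R : comPzRingType) (n : nat) (c : n.-tuple R) : infmx R :=
  semicirc (fun s => c`_s).

Lemma infmx_mul_semicirc_supp (R : comPzRingType) (d e : nat -> R) (i j : nat) :
  finite_set [set l | semicirc d i l * semicirc e l j != 0].
Proof.
apply: (@sub_finite_set _ _ `I_j.+1); last exact: finite_II.
move=> l /=; rewrite ltnS; apply: contraNT; rewrite -ltnNge => jl.
by rewrite /semicirc [(l <= j)%N]leqNgt jl mulr0.
Qed.

Lemma infmx_mul_semicirc (R : comPzRingType) (d e : nat -> R) :
  infmx_mul (semicirc d) (semicirc e) =
  semicirc (fun s => \sum_(l < s.+1) d l * e (s - l)%N).
Proof.
apply/funext => i; apply/funext => j; rewrite /infmx_mul.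
rewrite -(@fsbig_widen _ _ _ _ `I_j.+1); first last.
- move=> l [_ /= /negP]; rewrite ltnS -ltnNge => jl.
  by rewrite /semicirc [(l <= j)%N]leqNgt jl mulr0.
- by [].
rewrite -(fsbig_ord +%R j.+1 (fun l => semicirc d i l * semicirc e l j)).
rewrite [RHS]/semicirc; case: leqP => [ij|ji]; last first.
  apply: big1 => l _; rewrite /semicirc.
  by rewrite [(i <= l)%N]leqNgt (leq_trans (ltn_ord l) ji) mul0r.
rewrite -(big_mkord xpredT (fun l => semicirc d i l * semicirc e l j)).
rewrite (@big_cat_nat _ _ _ i) //=; last exact: leqW.
rewrite big1_seq ?add0r; last first.
  move=> l; rewrite mem_index_iota => /= li.
  by rewrite /semicirc leqNgt li mul0r.
rewrite -{1}[i]add0n big_addn subSn // big_mkord; apply: eq_bigr => l _.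
rewrite /semicirc leq_addl addnK.
have lj : (l + i <= j)%N.
  by have := ltn_ord l; rewrite ltnS -(leq_add2r i) subnK.
by rewrite lj [(l + i)%N]addnC subnDA.
Qed.

Lemma infmx_exp_semicirc (R : comPzRingType) (n : nat) (c : n.-tuple R) (k : nat) :
  exists (d : nat -> R) (N : nat), infmx_exp (semicirc_of c) k = semicirc d
    /\ forall s, (N <= s)%N -> d s = 0.
Proof.
elim: k => [|k [d [N [Ed d0]]]].
  exists (fun s => (s == 0)%:R), 1%N; split; last by case.
  apply/funext => i; apply/funext => j; rewrite /= /infmx_one /semicirc.
  rewrite subn_eq0; case: (leqP i j) => [ij|ji]; first by rewrite eqn_leq ij.
  by rewrite gtn_eqF.
exists (fun s => \sum_(l < s.+1) c`_l * d (s - l)%N), (n + N)%N; split.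
  by rewrite /infmx_exp iterS -/(infmx_exp _ _) Ed infmx_mul_semicirc.
move=> s ns; apply: big1 => l _; case: (ltnP l n) => ln.
  rewrite d0 ?mulr0 // leq_subRL; last by rewrite -ltnS.
  by apply: leq_trans ns; rewrite leq_add2r ltnW.
by rewrite nth_default ?mul0r ?size_tuple.
Qed.

(* The strips b_s(k) exist, and only finitely many of them are nonzero. *)
Lemma transT_exp_semicirc (R : comPzRingType) (n : nat) (r : R) (c : n.-tuple R)
    (k : nat) :
  exists b : nat -> R, transT n r (infmx_exp (semicirc_of c) k) = semicirc b
    /\ finite_set [set s | b s != 0].
Proof.
have [d [N [-> d0]]] := infmx_exp_semicirc c k.
exists (fun s => r ^+ (s %/ n) * d s); split.
  apply/funext => i; apply/funext => j; rewrite /transT /infmx_hadamard /semicirc.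
  by case: leqP => [ij|]; rewrite ?mulr0 // distnEl.
apply: (@sub_finite_set _ _ `I_N); last exact: finite_II.
by move=> s /=; apply: contraNT; rewrite -leqNgt => /d0 ->; rewrite mulr0.
Qed.

(* Main.v *)
(* Let Z = circ_{n,r}(0, 1, 0, ..., 0), read as the 1 x 1 matrix (r) when n = 1,
   so that Z^n = r.  If p is the polynomial with coefficients c_0, ..., c_{n-1},
   then C_{n,r} = p(Z), while [C_{n,r}]^k lists the coefficients d_s of p^k.
   Hence C_{n,r}^k is the sum of the d_s Z^s; writing s = nm + t with t < n gives
   Z^s = r^m Z^t, and b_s(k) = r^m d_s, so the block of index m is the m-th
   r-circulant. *)
Require Import Defs.
From mathcomp Require Import all_boot all_order all_algebra.
From mathcomp Require Import mathcomp_extra boolp classical_sets functions.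
From mathcomp Require Import cardinality fsbigop.
From mathcomp Require Import zify.

Set Implicit Arguments.
Unset Strict Implicit.

Import GRing.Theory.

Local Open Scope classical_set_scope.
Local Open Scope ring_scope.

(* [shiftmx r n s] is the [s]-th power of [circ_{n,r}(0, 1, 0, ..., 0)], described
   by its entries. *)
Definition shiftmx (R : comPzRingType) (r : R) (n s : nat) : 'M[R]_n :=
  \matrix_(i < n, j < n) (r ^+ ((i + s) %/ n) *+ ((i + s) %% n == j)%N).

Lemma shiftmx0 (R : comPzRingType) (r : R) (n : nat) : shiftmx r n 0 = 1%:M.
Proof.
by apply/matrixP => i j; rewrite !mxE addn0 divn_small // modn_small.
Qed.

(** Row [i] of a shift has a single possibly nonzero entry, in column [(i + s) %% n], so one term of
    each product sum survives. The exponents of [r] add up because dividing [i + s + t] by [n] can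
    be done in two stages. *)
Lemma shiftmxD (R : comPzRingType) (r : R) (n s t : nat) :
  shiftmx r n s *m shiftmx r n t = shiftmx r n (s + t).
Proof.
apply/matrixP => i j; rewrite !mxE.
have n0 : (0 < n)%N := leq_ltn_trans (leq0n i) (ltn_ord i).
have lt_mod : ((i + s) %% n < n)%N by rewrite ltn_pmod.
rewrite (bigD1 (Ordinal lt_mod)) //= big1 ?addr0; last first.
  by move=> l; rewrite !mxE -val_eqE eq_sym /= => /negPf ->; rewrite mul0r.
rewrite !mxE /= eqxx mulr1n mulrnAr -exprD addnA modnDml.
congr (r ^+ _ *+ _).
by rewrite [in RHS](divn_eq (i + s) n) -[in RHS]addnA divnMDl.
Qed.

(** Each full turn of length [n] costs one factor [r], which is the weight that [transT] puts on a
    strip. *)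
Lemma shiftmx_mulnD (R : comPzRingType) (r : R) (n m s : nat) : (0 < n)%N ->
  shiftmx r n (n * m + s) = r ^+ m *: shiftmx r n s.
Proof.
move=> n0; apply/matrixP => i j; rewrite !mxE addnCA mulnC divnMDl // modnMDl.
by rewrite exprD mulrnAr.
Qed.

Lemma circ_shiftmx (R : comPzRingType) (r : R) (n : nat) (c : n.-tuple R) :
  circ r c = \sum_(s < n) c`_s *: shiftmx r n s.
Proof.
apply/matrixP => i j; rewrite summxE !mxE.
have n0 : (0 < n)%N := leq_ltn_trans (leq0n i) (ltn_ord i).
(* The only shift below [n] that carries row [i] to column [j]: since [i + l < 2n], at most one wrap
   occurs, and it occurs exactly when [j < i]. *)
have lt_s : ((if (i <= j)%N then j - i else n + j - i) < n)%N.
  by case: (leqP i j) => ij; have := ltn_ord i; have := ltn_ord j; lia.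
rewrite (bigD1 (Ordinal lt_s)) //= big1 ?addr0; last first.
  move=> l /eqP ls; rewrite !mxE; case: eqP => [E|]; last by rewrite mulr0.
  case: ls; apply/val_inj => /=.
  have [lt|ge] := ltnP (i + l) n.
    by rewrite modn_small // in E; rewrite -E leq_addr addKn.
  have lt2 : (i + l - n < n)%N by have := ltn_ord i; have := ltn_ord l; lia.
  rewrite -(subnK ge) modnDr modn_small // in E.
  by rewrite -E; have := ltn_ord l; case: (leqP i); lia.
rewrite !mxE; case: leqP => ij.
  by rewrite subnKC // modn_small // divn_small // eqxx mulr1.
rewrite subnKC; last by have := ltn_ord i; lia.
rewrite modnDl modn_small // divnDl ?dvdnn // divnn n0 divn_small // eqxx.
by rewrite expr1 mulrC.
Qed.

Lemma big_nat_trim (V : nmodType) (f : nat -> V) (N M : nat) :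
  (N <= M)%N -> (forall s, (N <= s)%N -> f s = 0) ->
  \sum_(0 <= s < M) f s = \sum_(0 <= s < N) f s.
Proof.
move=> NM f0; rewrite (@big_cat_nat _ _ _ N) //= [X in _ + X]big_nat_cond.
by rewrite [X in _ + X]big1 ?addr0 // => s /andP[/andP[Ns _] _]; exact: f0.
Qed.

Lemma big_nat_blocks (V : nmodType) (f : nat -> V) (n M : nat) :
  \sum_(0 <= m < M) \sum_(s < n) f (n * m + s)%N = \sum_(0 <= t < n * M) f t.
Proof.
rewrite mulnC big_nat_mul; apply: eq_bigr => m _.
rewrite -{1}[(m * n)%N]add0n big_addn mulSn addnK big_mkord.
by apply: eq_bigr => s _; rewrite addnC mulnC.
Qed.

(* Substituting the shift for the variable turns convolution into product. *)
Lemma mulmx_shiftmx_conv (R : comPzRingType) (r : R) (n : nat) (e d : nat -> R)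
    (K N : nat) :
  (forall l, (K <= l)%N -> e l = 0) -> (forall s, (N <= s)%N -> d s = 0) ->
  (\sum_(0 <= l < K) e l *: shiftmx r n l) *m
    (\sum_(0 <= s < N) d s *: shiftmx r n s) =
  \sum_(0 <= s < K + N) (\sum_(l < s.+1) e l * d (s - l)%N) *: shiftmx r n s.
Proof.
move=> e0 d0; rewrite mulmx_suml.
under [RHS]eq_bigr do rewrite scaler_suml -(big_mkord xpredT
  (fun l => (e l * d (_ - l)%N) *: shiftmx r n _)).
(* The bound [l <= s] becomes a condition over a common range, so that the two sums can be
   exchanged. *)
transitivity (\sum_(0 <= s < K + N) \sum_(0 <= l < K + N | (l <= s)%N)
    (e l * d (s - l)%N) *: shiftmx r n s); last first.
  apply: eq_big_nat => s /andP[_ sKN].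
  by rewrite (big_nat_widen 0 s.+1 (K + N)).
rewrite (exchange_big_dep_nat xpredT) //=.
rewrite [RHS](@big_nat_trim _ _ K) ?leq_addr //; last first.
  by move=> l Kl; apply: big1 => s _; rewrite e0 // mul0r scale0r.
apply: eq_big_nat => l /andP[_ lK].
rewrite mulmx_sumr.
(* Padding with zero terms up to [K + N - l], at least [N] because [l < K], makes the range match
   after translation by [l]. *)
rewrite -(@big_nat_trim _ _ N (K + N - l)); [|lia|]; last first.
  by move=> s Ns; rewrite d0 // scale0r mulmx0.
rewrite -(big_nat_widenl l 0 (K + N) xpredT) //.
rewrite -[in RHS](add0n l) big_addn; apply: eq_bigr => s _.
by rewrite addnK -scalemxAl -scalemxAr shiftmxD scalerA addnC.
Qed.

(** A single induction produces one sequence [d] for both the infinite and the finite power, so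
    their coefficients agree by construction. *)
Lemma circ_exp_shiftmx (R : comPzRingType) (r : R) (n : nat) (c : n.-tuple R)
    (k : nat) :
  exists (d : nat -> R) (N : nat), [/\ infmx_exp (semicirc_of c) k = semicirc d,
    forall s, (N <= s)%N -> d s = 0 &
    circ r c ^+ k = \sum_(0 <= s < N) d s *: shiftmx r n s].
Proof.
elim: k => [|k [d [N [Ed d0 EC]]]].
  exists (fun s => (s == 0)%:R), 1%N; split; [|by case|].
    apply/funext => i; apply/funext => j; rewrite /= /infmx_one /semicirc.
    by rewrite subn_eq0 eqn_leq; case: leqP.
  by rewrite big_nat1 shiftmx0 scale1r expr0.
have c0 l : (n <= l)%N -> c`_l = 0 by move=> nl; rewrite nth_default ?size_tuple.
exists (fun s => \sum_(l < s.+1) c`_l * d (s - l)%N), (n + N)%N; split.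
- by rewrite /infmx_exp iterS -/(infmx_exp _ _) Ed infmx_mul_semicirc.
- move=> s ns; apply: big1 => l _; have [ln|/c0->] := ltnP l n; last by rewrite mul0r.
  by rewrite d0 ?mulr0 //; lia.
- rewrite exprS EC circ_shiftmx.
  rewrite -(big_mkord xpredT (fun s => c`_s *: shiftmx r n s)).
  exact: mulmx_shiftmx_conv.
Qed.

Unset Implicit Arguments.
Set Strict Implicit.

Theorem theorem4p1 (R : comPzRingType) (r : R) (n : nat) (hn : (0 < n)%N)
    (c : n.-tuple R) (k : nat) (b : nat -> R)
    (hb : transT n r (infmx_exp (semicirc_of c) k) = semicirc b) :
  circ r c ^+ k =
  \sum_(m \in [set: nat]) circ r [tuple b (n * m + s)%N | s < n].
Proof.
have [d [N [Ed d0 ->]]] := circ_exp_shiftmx r c k.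
(* Row 0 of a semicirculant matrix lists its whole sequence, so [hb] determines [b]. *)
have bE s : b s = r ^+ (s %/ n) * d s.
  have := congr1 (fun A : infmx R => A 0%N s) hb.
  by rewrite Ed /transT /infmx_hadamard /semicirc distnEl // leq0n subn0.
have blockE m : circ r [tuple b (n * m + s)%N | s < n] =
    \sum_(s < n) d (n * m + s)%N *: shiftmx r n (n * m + s).
  rewrite circ_shiftmx; apply: eq_bigr => s _.
  rewrite -tnth_nth tnth_mktuple bE shiftmx_mulnD // scalerA mulrC mulnC.
  by rewrite divnMDl // divn_small // addn0.
(* [N] blocks suffice: as [n] is positive, block [m >= N] only involves indices from [n * m >= N]
   on, where [d] vanishes. *)
rewrite -(@fsbig_widen _ _ _ _ `I_N) //; last first.
  move=> m [_ /= /negP]; rewrite -leqNgt => Nm.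
  rewrite blockE; apply: big1 => s _; rewrite d0 ?scale0r //.
  by rewrite (leq_trans Nm) // (leq_trans _ (leq_addr _ _)) // leq_pmull.
rewrite -(fsbig_ord +%R N (fun m => circ r [tuple b (n * m + s)%N | s < n])).
rewrite -(big_mkord xpredT (fun m => circ r [tuple b (n * m + s)%N | s < n])).
under [RHS]eq_bigr do rewrite blockE.
rewrite (big_nat_blocks (fun s => d s *: shiftmx r n s)).
rewrite (@big_nat_trim _ _ N) ?leq_pmull // => s Ns.
by rewrite d0 // scale0r.
Qed.
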